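(* A random infinite rooted permutation is shift-invariant if and only if it is the limit, in the annealed Benjamini--Schramm sense, of some sequence of random (finite) permutations.
   Context: All intervals $[a,b]$ are integer intervals. $\mathcal{S}^n$ is the set of permutations $\sigma=\sigma_1\cdots\sigma_n$ of $[n]=\{1,\dots,n\}$, $|\sigma|=n$ is the size, and $\mathcal{S}=\bigcup_{n\ge1}\mathcal{S}^n$. Rooted permutations. A finite rooted permutation is a pair $(\sigma,i)$ with $\sigma\in\mathcal{S}^n$, $i\in[n]$. It is identified with the pair $(A_{\sigma,i},\preccurlyeq_{\sigma,i})$, where $A_{\sigma,i}=[-i+1,|\sigma|-i]$ and $\preccurlyeq_{\sigma,i}$ is the total order on it given by $\ell\preccurlyeq_{\sigma,i}j\iff\sigma_{\ell+i}\le\sigma_{j+i}$; this is a bijection between finite rooted permutations and total orders on finite integer intervals containing $0$. An infinite rooted permutation is a pair $(A,\preccurlyeq)$ with $A$ an infinite integer interval containing $0$ and $\preccurlyeq$ a total order on $A$. $\tilde{\mathcal{S}}_\bullet$ is the set of all finite and infinite rooted permutations. For $h\in\mathbb{Z}_{>0}$, $r_h(A,\preccurlyeq)=(A\cap[-h,h],\preccurlyeq)$. The local distance on $\tilde{\mathcal{S}}_\bullet$ is $d(x,y)=2^{-\sup\{h\in\mathbb{Z}_{>0}:\,r_h(x)=r_h(y)\}}$, with $\sup\emptyset=0$, $\sup\mathbb{Z}_{>0}=+\infty$, $2^{-\infty}=0$. Annealed convergence: a sequence $(\boldsymbol{\sigma}^n)$ of random permutations in $\mathcal{S}$ converges in the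 annealed Benjamini--Schramm sense to a random variable $\boldsymbol{\sigma}^\infty$ with values in $\tilde{\mathcal{S}}_\bullet$ if, with $\boldsymbol{i}_n$ a uniform index of $\boldsymbol{\sigma}^n$ conditionally on $\boldsymbol{\sigma}^n$, the random rooted permutations $(\boldsymbol{\sigma}^n,\boldsymbol{i}_n)$ converge in distribution to $\boldsymbol{\sigma}^\infty$ with respect to $d$. Shift-invariance: for $\pi\in\mathcal{S}^k$ and $s\in\mathbb{Z}$ let $O^s(\pi)=\{(A,\preccurlyeq)\in\tilde{\mathcal{S}}_\bullet:[1+s,k+s]\subseteq A\text{ and }\pi_1+s\preccurlyeq\pi_2+s\preccurlyeq\cdots\preccurlyeq\pi_k+s\}$ and $O(\pi)=O^0(\pi)$. A random rooted permutation $(\boldsymbol{A},\boldsymbol{\preccurlyeq})$ with values in $\tilde{\mathcal{S}}_\bullet$ is shift-invariant if $\mathbb{P}((\boldsymbol{A},\boldsymbol{\preccurlyeq})\in O^s(\pi))=\mathbb{P}((\boldsymbol{A},\boldsymbol{\preccurlyeq})\in O(\pi))$ for all $\pi\in\mathcal{S}$ and all $s\in\mathbb{Z}$. *)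

(* Defs.v *)
From HB Require Import structures.
From mathcomp Require Import all_boot all_order all_fingroup all_algebra.
From mathcomp Require Import all_classical all_reals all_analysis.
From mathcomp Require Import zify lra.

Set Implicit Arguments.
Unset Strict Implicit.
Unset Printing Implicit Defensive.

Import Order.TTheory GRing.Theory Num.Theory.
Import numFieldNormedType.Exports.

Local Open Scope classical_set_scope.
Local Open Scope ring_scope.

(* Values and positions of permutations are 0-based: ['S_n.+1] permutes
   {0, ..., n} instead of [n + 1] = {1, ..., n + 1}. *)
Definition fperm : Type := {n : nat & 'S_n.+1}.

Definition psize (s : fperm) : nat := (tag s).+1.

Definition pfun (s : fperm) : 'S_(psize s) := tagged s.

HB.instance Definition _ := Choice.on fperm.
HB.instance Definition _ :=
  isPointed.Build fperm (existT (fun n => 'S_n.+1) 0%N 1%g).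
HB.instance Definition _ := @isMeasurable.Build default_measure_display
  fperm discrete_measurable discrete_measurable0
  discrete_measurableC discrete_measurableU.

(* The relation [rle] is supported on the carrier, so that two rooted
   permutations are equal as pairs (A, order on A) iff they are Leibniz equal. *)
Record rperm : Type := RPerm {
  carrier : set int ;
  rle : int -> int -> Prop ;
  carrier_itv : is_interval carrier ;
  carrier0 : carrier 0 ;
  rle_carrier : forall l j, rle l j -> carrier l /\ carrier j ;
  rle_trans : forall l j k, rle l j -> rle j k -> rle l k ;
  rle_anti : forall l j, rle l j -> rle j l -> l = j ;
  (* the case l = j gives reflexivity *)
  rle_total : forall l j, carrier l -> carrier j -> rle l j \/ rle j l }.

Lemma rperm_eq (x y : rperm) :
  carrier x = carrier y -> rle x = rle y -> x = y.
Proof.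
case: x y => [A r p1 p2 p3 p4 p5 p6] [B r' q1 q2 q3 q4 q5 q6] /= AB rr'.
move: p1 p2 p3 p4 p5 p6; rewrite AB rr' => p1 p2 p3 p4 p5 p6.
by congr RPerm; exact: Prop_irrelevance.
Qed.

Definition infinite_rperm (x : rperm) : Prop := infinite_set (carrier x).

Section rooting.
Variables (s : fperm) (i : 'I_(psize s)).

(* With the 0-based index [i], the carrier is [-i, |s| - 1 - i]. *)
Definition root_carrier : set int :=
  [set l | - i%:Z <= l < (psize s)%:Z - i%:Z].

Definition root_rle (l j : int) : Prop :=
  exists a b : 'I_(psize s),
    [/\ a%:Z = l + i%:Z, b%:Z = j + i%:Z & (pfun s a <= pfun s b)%N].

Lemma root_carrierP l :
  root_carrier l -> exists a : 'I_(psize s), a%:Z = l + i%:Z.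
Proof.
rewrite /root_carrier /= => /andP[l1 l2].
pose m := absz (l + i%:Z).
have h : (m < psize s)%N by rewrite /m; lia.
by exists (Ordinal h) => /=; rewrite /m; lia.
Qed.

Lemma root_itv : is_interval root_carrier.
Proof. by move=> x y; rewrite /root_carrier /= => hx hy z hz; lia. Qed.

Lemma root_carrier0 : root_carrier 0.
Proof. by rewrite /root_carrier /=; have := ltn_ord i; lia. Qed.

Lemma root_rle_carrier l j :
  root_rle l j -> root_carrier l /\ root_carrier j.
Proof.
move=> [a [b [la jb _]]]; rewrite /root_carrier /=.
by have := ltn_ord a; have := ltn_ord b; split; lia.
Qed.

Lemma root_rle_trans l j k : root_rle l j -> root_rle j k -> root_rle l k.
Proof.
move=> [a [b [la jb ab]]] [b' [c [jb' kc bc]]].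
have e : b' = b by apply: val_inj => /=; lia.
by subst b'; exists a, c; split=> //; exact: leq_trans ab bc.
Qed.

Lemma root_rle_anti l j : root_rle l j -> root_rle j l -> l = j.
Proof.
move=> [a [b [la jb ab]]] [b' [a' [jb' la' ba]]].
have e : b' = b by apply: val_inj => /=; lia.
have e' : a' = a by apply: val_inj => /=; lia.
subst a' b'.
have : pfun s a = pfun s b by apply/val_inj/eqP; rewrite eqn_leq ab ba.
by move/perm_inj => ab'; subst b; lia.
Qed.

Lemma root_rle_total l j :
  root_carrier l -> root_carrier j -> root_rle l j \/ root_rle j l.
Proof.
move=> /root_carrierP[a la] /root_carrierP[b jb].
case: (leqP (pfun s a) (pfun s b)) => [ab|/ltnW ba].
- by left; exists a, b.
- by right; exists b, a.
Qed.

Definition root_at : rperm :=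
  RPerm root_itv root_carrier0 root_rle_carrier root_rle_trans
    root_rle_anti root_rle_total.

End rooting.

Section restriction.
Variables (h : nat) (x : rperm).

Definition restr_carrier : set int :=
  carrier x `&` [set l | - h%:Z <= l <= h%:Z].

Definition restr_rle (l j : int) : Prop :=
  [/\ rle x l j, restr_carrier l & restr_carrier j].

Lemma restr_itv : is_interval restr_carrier.
Proof.
move=> a b [xa ha] [xb hb] c cab; split; first exact: (carrier_itv xa xb).
by move: ha hb => /=; lia.
Qed.

Lemma restr_carrier0 : restr_carrier 0.
Proof. by split; [exact: carrier0|rewrite /=; lia]. Qed.

Lemma restr_rle_carrier l j :
  restr_rle l j -> restr_carrier l /\ restr_carrier j.
Proof. by case. Qed.

Lemma restr_rle_trans l j k : restr_rle l j -> restr_rle j k -> restr_rle l k.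
Proof. by move=> [lj hl _] [jk _ hk]; split=> //; exact: rle_trans lj jk. Qed.

Lemma restr_rle_anti l j : restr_rle l j -> restr_rle j l -> l = j.
Proof. by move=> [lj _ _] [jl _ _]; exact: rle_anti lj jl. Qed.

Lemma restr_rle_total l j :
  restr_carrier l -> restr_carrier j -> restr_rle l j \/ restr_rle j l.
Proof.
by move=> hl hj; have [lj|jl] := rle_total hl.1 hj.1; [left|right]; split.
Qed.

Definition restr : rperm :=
  RPerm restr_itv restr_carrier0 restr_rle_carrier restr_rle_trans
    restr_rle_anti restr_rle_total.

End restriction.

Definition agree (x y : rperm) : set nat :=
  [set h | (0 < h)%N /\ restr h x = restr h y].

Lemma agree_le x y g h : (0 < g <= h)%N -> agree x y h -> agree x y g.
Proof.
move=> /andP[g0 gh] [_ e]; split=> //.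
have gc z : restr_carrier g z = restr_carrier h z `&` [set l | - g%:Z <= l <= g%:Z].
  apply/seteqP; split=> l; rewrite /restr_carrier /=.
  - by move=> [zl ?]; split=> //; split=> //; lia.
  - by move=> [[zl _] ?].
have gr z : restr_rle g z = fun l j =>
    [/\ restr_rle h z l j, restr_carrier g z l & restr_carrier g z j].
  apply/funext => l; apply/funext => j; apply/propext; split.
  - move=> [lj hl hj]; split=> //; split=> //.
    + by move: hl; rewrite gc => -[].
    + by move: hj; rewrite gc => -[].
  - by move=> [[lj _ _] hl hj].
have ec : restr_carrier h x = restr_carrier h y := congr1 carrier e.
have er : restr_rle h x = restr_rle h y := congr1 rle e.
have ecg : restr_carrier g x = restr_carrier g y by rewrite !gc ec.
by apply: rperm_eq => /=; rewrite // !gr ecg er.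
Qed.

Lemma agree_sym x y : agree x y = agree y x.
Proof. by apply/seteqP; split=> h [h0 e]; split. Qed.

Lemma agree_all x y : (forall h, (0 < h)%N -> agree x y h) -> x = y.
Proof.
move=> xy; apply: rperm_eq.
- apply/funext => l; apply/propext.
  have [|_ /(congr1 carrier)/=/(congr1 (@^~ l))] := xy (absz l).+1; first by [].
  have hl : - (absz l).+1%:Z <= l <= (absz l).+1%:Z by lia.
  rewrite /restr_carrier /setI/= hl => e.
  split=> xl; first by have [] : carrier y l /\ true by rewrite -e.
  by have [] : carrier x l /\ true by rewrite e.
- apply/funext => l; apply/funext => j; apply/propext.
  pose h := (absz l + absz j).+1.
  have [//|_ /(congr1 rle)/=] := xy h.
  move=> /(congr1 (fun r => r l j)) e.
  have hl : - h%:Z <= l <= h%:Z by rewrite /h; lia.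
  have hj : - h%:Z <= j <= h%:Z by rewrite /h; lia.
  have P z : rle z l j -> restr_rle h z l j.
    by move=> lj; have [cl cj] := rle_carrier lj.
  split=> lj.
  + by have [] : restr_rle h y l j by rewrite -e; exact: P.
  + by have [] : restr_rle h x l j by rewrite e; exact: P.
Qed.

Section local_distance.
Variable R : realType.

(* [ereal_sup set0 = -oo]; the maximum with 0 implements sup set0 = 0. *)
Definition agree_sup (x y : rperm) : \bar R :=
  maxe 0%E (ereal_sup [set (h%:R)%:E | h in agree x y]).

Definition local_dist (x y : rperm) : R :=
  if agree_sup x y is r%:E then 2 `^ (- r) else 0.

Lemma agree_sup_ge0 x y : (0 <= agree_sup x y)%E.
Proof. by rewrite le_max lexx. Qed.

Lemma agree_sup_ub x y h : agree x y h -> ((h%:R)%:E <= agree_sup x y)%E.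
Proof.
by move=> xyh; rewrite le_max; apply/orP; right; apply: ereal_sup_ubound; exists h.
Qed.

Lemma agree_of_sup x y h : (0 < h)%N ->
  ((h%:R)%:E <= agree_sup x y)%E -> agree x y h.
Proof.
move=> h0; rewrite le_max => /orP[|hs]; first by rewrite lee_fin lern0; lia.
have : ((h%:R - 1 / 2 : R)%R%:E < ereal_sup [set (k%:R : R)%:E | k in agree x y])%E.
  by apply: (lt_le_trans _ hs); rewrite lte_fin; lra.
move=> /ereal_sup_gt[_ [k xyk <-]]; rewrite lte_fin => hk.
apply: agree_le xyk; rewrite h0 /= leqNgt; apply/negP => kh.
have : (k.+1%:R <= h%:R :> R) by rewrite ler_nat.
by rewrite -natr1; lra.
Qed.

Lemma local_dist_ge0 x y : 0 <= local_dist x y.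
Proof. by rewrite /local_dist; case: agree_sup => // r; exact: powR_ge0. Qed.

Lemma local_dist_anti x y z t :
  (agree_sup x y <= agree_sup z t)%E -> local_dist z t <= local_dist x y.
Proof.
rewrite {1 2}/local_dist; have := agree_sup_ge0 z t.
case: (agree_sup z t) => [r| |] //.
- case: (agree_sup x y) (agree_sup_ge0 x y) => [r'| |] // _ _.
  by rewrite lee_fin => rr'; rewrite ler_powR ?lerN2 ?ler1n.
- by move=> _ _; exact: local_dist_ge0.
Qed.

Lemma local_distxx x : local_dist x x = 0.
Proof.
rewrite /local_dist.
have : (forall n, (0 < n)%N -> (n%:R)%:E <= agree_sup x x)%E.
  by move=> n n0; apply: agree_sup_ub.
case: agree_sup => // r hr.
have := hr (Num.truncn r).+1 isT; rewrite lee_fin leNgt.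
by rewrite truncnS_gt.
Qed.

Lemma local_dist_eq0 x y : local_dist x y = 0 -> x = y.
Proof.
rewrite /local_dist => e; apply: agree_all => h h0; apply: agree_of_sup => //.
move: e (agree_sup_ge0 x y); case: agree_sup => [r e _| |] //.
- have : 0 < (2 : R) `^ (- r) by rewrite powR_gt0.
  by rewrite e ltxx.
- by move=> _ _; rewrite leey.
Qed.

Lemma local_dist_sym x y : local_dist x y = local_dist y x.
Proof. by rewrite /local_dist /agree_sup agree_sym. Qed.

Lemma local_dist_triangle y x z :
  local_dist x z <= local_dist x y + local_dist y z.
Proof.
have key (s : \bar R) : (s <= agree_sup x y)%E -> (s <= agree_sup y z)%E ->
    (forall h, (0 < h)%N -> ((h%:R)%:E <= s)%E -> ((h%:R)%:E <= agree_sup x z)%E).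
  move=> s1 s2 h h0 hs; apply: agree_sup_ub.
  have [_ e1] : agree x y h by apply: agree_of_sup (le_trans hs s1).
  have [_ e2] : agree y z h by apply: agree_of_sup (le_trans hs s2).
  by split=> //; rewrite e1.
have sup_le u v : (forall h, (0 < h)%N -> ((h%:R)%:E <= agree_sup u v)%E ->
    ((h%:R)%:E <= agree_sup x z)%E) -> (agree_sup u v <= agree_sup x z)%E.
  move=> H; rewrite {1}/agree_sup ge_max agree_sup_ge0 /=.
  apply: ge_ereal_sup => _ [h uvh <-]; apply: H; first by case: uvh.
  exact: agree_sup_ub.
have [le|/ltW le] := leP (agree_sup x y) (agree_sup y z).
- apply: (@le_trans _ _ (local_dist x y)); last by rewrite lerDl local_dist_ge0.
  by apply: local_dist_anti; apply: sup_le; apply: key.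
- apply: (@le_trans _ _ (local_dist y z)); last by rewrite lerDr local_dist_ge0.
  by apply: local_dist_anti; apply: sup_le; apply: key.
Qed.

End local_distance.

(* The parameter [R] only serves to make the metric structure inferable. *)
Definition rpermM (R : realType) : Type := rperm.

HB.instance Definition _ (R : realType) := gen_eqMixin (rpermM R).
HB.instance Definition _ (R : realType) := gen_choiceMixin (rpermM R).
HB.instance Definition _ (R : realType) :=
  isPointed.Build (rpermM R) (root_at (ord0 : 'I_(psize point))).
HB.instance Definition _ (R : realType) := @isMetric.Build R (rpermM R)
  (@local_dist R) (@local_distxx R) (@local_dist_eq0 R) (@local_dist_sym R)
  (@local_dist_triangle R).

Definition rpermB (R : realType) := g_sigma_algebraType (@open (rpermM R)).

(* The event O^s(pi); [pfun pi a] is 0-based, hence the successor. *)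
Definition occ (s : int) (pi : fperm) : set rperm :=
  [set x | (forall l : int, 1 + s <= l <= (psize pi)%:Z + s -> carrier x l) /\
    forall a b : 'I_(psize pi), b = a.+1 :> nat ->
      rle x ((pfun pi a).+1%:Z + s) ((pfun pi b).+1%:Z + s)].

Section random_rooted_permutations.
Variable R : realType.

Definition shift_invariant d (T : measurableType d) (P : probability T R)
    (X : {RV P >-> rpermB R}) : Prop :=
  forall (pi : fperm) (s : int), P (X @^-1` occ s pi) = P (X @^-1` occ 0 pi).

Definition uniform_index d (T : measurableType d) (P : probability T R)
    (sigma : {RV P >-> fperm}) (i : forall w, 'I_(psize (sigma w))) : Prop :=
  measurable_fun [set: T] (fun w => i w : nat) /\
  forall (s : fperm) (j : nat), (j < psize s)%N ->
    P [set w | sigma w = s /\ (i w : nat) = j] =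
    (P [set w | sigma w = s] * ((psize s)%:R^-1)%:E)%E.

Definition cvg_in_distribution
    (d : nat -> measure_display) (T : forall n, measurableType (d n))
    (P : forall n, probability (T n) R) (Y : forall n, T n -> rpermM R)
    d0 (T0 : measurableType d0) (P0 : probability T0 R)
    (X : T0 -> rpermM R) : Prop :=
  forall f : rpermM R -> R, continuous f -> (exists M, forall x, `|f x| <= M) ->
    ('E_(P n)[f \o Y n])%E @[n --> \oo] --> ('E_P0[f \o X])%E.

(* The probability spaces are assumed to carry the uniform indices [i n]. *)
Definition annealed_BS_cvg
    (d : nat -> measure_display) (T : forall n, measurableType (d n))
    (P : forall n, probability (T n) R)
    (sigma : forall n, {RV (P n) >-> fperm})
    (i : forall n w, 'I_(psize (sigma n w)))
    d0 (T0 : measurableType d0) (P0 : probability T0 R)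
    (X : {RV P0 >-> rpermB R}) : Prop :=
  (forall n, uniform_index (i n)) /\
  cvg_in_distribution P (fun n w => root_at (i n w)) P0 X.

End random_rooted_permutations.

(* Main.v *)
(* If X is the limit of (sigma_n, i_n), then the number of roots of sigma_n at
   which a consecutive pattern occurs at offset s differs from the number for
   offset 0 by at most |s|; after division by |sigma_n|, which tends to infinity
   in probability since X is infinite, this vanishes in the limit, and the
   occurrence events are clopen for the local distance.

   Conversely, if X is shift-invariant then its carrier is a.s. the whole of int,
   and the limit is approached by the pattern of X on [0, n], rooted uniformly:
   away from the boundary, a window around the root has the law of the window of
   X around 0. For f >= 0 and local g with g <= f this gives
   liminf E f(sigma_n, i_n) >= E g(X); as f is the increasing limit of its infima
   over balls, which are local, liminf E f(sigma_n, i_n) >= E f(X) for f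
   continuous, and it remains to apply this to M + f and M - f with |f| <= M. *)
From HB Require Import structures.
Require Import Defs.
From mathcomp Require Import all_boot all_order all_fingroup all_algebra.
From mathcomp Require Import all_classical all_reals all_analysis.
From mathcomp Require Import measurable_realfun zify lra.

Set Implicit Arguments.
Unset Strict Implicit.
Unset Printing Implicit Defensive.

Import Order.TTheory GRing.Theory Num.Theory.
Import numFieldNormedType.Exports.

Local Open Scope classical_set_scope.
Local Open Scope ring_scope.

(** * Local functions *)

(** Since [U] is arbitrary, this covers events ([U := Prop]), real functions and patterns alike. *)
Definition local_fun (h : nat) (U : Type) (g : rperm -> U) : Prop :=
  forall x y, restr h x = restr h y -> g x = g y.

Lemma restr_carrierE h x y (l : int) : restr h x = restr h y ->
  - h%:Z <= l <= h%:Z -> carrier x l -> carrier y l.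
Proof.
move=> /(congr1 carrier)/=/(congr1 (@^~ l)) e hl xl.
by have [] : restr_carrier h y l by rewrite -e.
Qed.

Lemma restr_rleE h x y (l j : int) : restr h x = restr h y ->
  - h%:Z <= l <= h%:Z -> - h%:Z <= j <= h%:Z -> rle x l j -> rle y l j.
Proof.
move=> /(congr1 rle)/=/(congr1 (fun r => r l j)) e hl hj lj.
have [xl xj] := rle_carrier lj.
by have [] : restr_rle h y l j by rewrite -e.
Qed.

Lemma restr_eqP h x y :
  (forall l : int, - h%:Z <= l <= h%:Z -> carrier x l <-> carrier y l) ->
  (forall l j : int, - h%:Z <= l <= h%:Z -> - h%:Z <= j <= h%:Z ->
    rle x l j <-> rle y l j) ->
  restr h x = restr h y.
Proof.
move=> hc hr; apply: rperm_eq => /=.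
  apply/seteqP; split=> l [/= xl hl]; split=> //; exact/(hc _ hl).
apply/funext => l; apply/funext => j; apply/propext.
split=> -[lj [/= xl hl] [/= xj hj]]; split; first [exact/(hr _ _ hl hj) |
  split=> //; first [exact/(hc _ hl) | exact/(hc _ hj)]].
Qed.

(** * Topology of the local distance, and measurability of local events *)

Section topology.
Variable R : realType.
Implicit Types x y : rpermM R.

Lemma local_dist_lt h x y : (0 < h)%N ->
  local_dist R x y < 2 `^ (- h%:R) -> restr h x = restr h y.
Proof.
move=> h0; rewrite ltNge => xy; apply: (agree_of_sup (R := R) h0 _).2.
rewrite leNgt; apply/negP => lt; move: xy => /negP; apply.
rewrite /local_dist; have := agree_sup_ge0 R x y; move: lt.
case: agree_sup => [r| |] //.
by rewrite lte_fin => rh _; rewrite ler_powR ?ler1n// lerN2 ltW.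
Qed.

Lemma local_dist_le h x y : (0 < h)%N -> restr h x = restr h y ->
  local_dist R x y <= 2 `^ (- h%:R).
Proof.
move=> h0 xy.
have : ((h%:R)%:E <= agree_sup R x y)%E by apply: agree_sup_ub.
rewrite /local_dist; case: agree_sup => [r| |] //.
  by rewrite lee_fin => hr; rewrite ler_powR ?ler1n// lerN2.
Qed.

(** Together with [nbhs_restr_sub]: the classes of equal windows form a neighbourhood basis, so that
    local functions are locally constant. *)
Lemma nbhs_restr h x : (0 < h)%N -> nbhs x [set y | restr h x = restr h y].
Proof.
move=> h0; apply/nbhs_ballP; exists (2 `^ (- h%:R)); first by rewrite /= powR_gt0.
by move=> y; rewrite ballEmdist /= => /local_dist_lt; exact.
Qed.

Lemma nbhs_restr_sub x (A : set (rpermM R)) : nbhs x A ->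
  exists2 h, (0 < h)%N & forall y, restr h x = restr h y -> A y.
Proof.
move=> /nbhs_ballP[e /= e0 xA].
have [h he] : exists h : nat, 2 `^ (- h.+1%:R) < e.
  have [h _ hh] : \forall h \near \oo, (2^-1 : R) ^+ h < e.
    near=> h.
    rewrite -[_ ^+ h]ger0_norm//.
    near: h; apply: cvgr0_norm_lt => //; apply: cvg_expr.
    by rewrite ger0_norm// invf_lt1// ltr1n.
  by exists h; rewrite powRN powR_mulrn// -exprVn; apply: hh => /=.
exists h.+1 => // y xy; apply: xA; rewrite ballEmdist /=.
exact: le_lt_trans (local_dist_le _ _) he.
Unshelve. all: by end_near. Qed.

Lemma local_open h (A : set (rpermM R)) : (0 < h)%N ->
  local_fun h A -> open A.
Proof.
move=> h0 hA; rewrite openE => x Ax.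
by apply: filterS (nbhs_restr x h0) => y /hA <-.
Qed.

Lemma local_continuous h (g : rpermM R -> R) : (0 < h)%N ->
  local_fun h g -> continuous g.
Proof.
move=> h0 hg x A Agx; apply: filterS (nbhs_restr x h0) => y /hg e.
by rewrite /= -e; exact: nbhs_singleton.
Qed.

Context d (T : measurableType d) (P : probability T R) (X : {RV P >-> rpermB R}).

Lemma measurable_preimage_open (A : set (rpermM R)) :
  open A -> measurable (X @^-1` A).
Proof.
move=> oA; rewrite -[X @^-1` A]setTI; apply: (measurable_funP X) => //.
exact: sub_sigma_algebra.
Qed.

Lemma measurable_preimage_local h (A : set rperm) : (0 < h)%N ->
  local_fun h A -> measurable (X @^-1` A).
Proof. by move=> h0 hA; exact/measurable_preimage_open/(local_open h0 hA). Qed.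

Lemma measurable_continuous_comp (g : rpermM R -> R) : continuous g ->
  measurable_fun [set: T] (g \o X).
Proof.
move=> /continuousP cg; apply: (measurability _ (RGenOpens.measurableE R)).
move=> _ [_ [a [b ->] <-]]; rewrite setTI.
apply: (measurable_preimage_open (A := g @^-1` `]a, b[)); apply: cg.
exact: (@interval_open R (BRight a) (BLeft b)).
Qed.

End topology.

(** * Patterns on windows *)

Section pattern.
Variables (c : int) (k : nat).
Implicit Types x y : rperm.

Definition rank_set x (q : 'I_k.+1) : {set 'I_k.+1} :=
  [set q' : 'I_k.+1 | `[< rle x (c + q'%:Z) (c + q%:Z) >] & q' != q].

(** The standardization of the order of [x] on [c, c + k], each position being sent to its rank. The
    default [1] of [insubd] makes [pat] total; it does not arise when the window lies in the
    carrier. *)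
Definition pat x : 'S_k.+1 :=
  insubd (1%g : 'S_k.+1) [ffun q => inord #|rank_set x q| : 'I_k.+1].

Definition full_on x := forall l : int, c <= l <= c + k%:Z -> carrier x l.

Lemma full_onE x (q : 'I_k.+1) : full_on x -> carrier x (c + q%:Z).
Proof. by move=> fx; apply: fx; have := ltn_ord q; lia. Qed.

Lemma card_rank_set x q : (#|rank_set x q| < k.+1)%N.
Proof.
rewrite -[X in (_ < X)%N]card_ord -cardsT; apply: proper_card.
by apply/properP; split=> //; exists q; rewrite ?inE// eqxx andbF.
Qed.

(** Transitivity gives the inclusion of rank sets, which is strict because [q] itself lies only in
    the larger one. *)
Lemma card_rank_set_lt x (q r : 'I_k.+1) : rle x (c + q%:Z) (c + r%:Z) ->
  q != r -> (#|rank_set x q| < #|rank_set x r|)%N.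
Proof.
move=> qr neq; apply: proper_card; apply/properP; split.
  apply/fintype.subsetP => p; rewrite !inE => /andP[/asboolP pq npq].
  apply/andP; split; first by apply/asboolP; exact: rle_trans pq qr.
  apply: contra npq => /eqP pr; subst p; apply/eqP/val_inj => /=.
  by have := rle_anti pq qr; lia.
by exists q; rewrite !inE ?eqxx ?andbF// neq andbT; apply/asboolP.
Qed.

Lemma patE x (q : 'I_k.+1) : full_on x -> pat x q = #|rank_set x q| :> nat.
Proof.
move=> fx; rewrite /pat.
have inj : injective [ffun q => inord #|rank_set x q| : 'I_k.+1].
  move=> a b; rewrite !ffunE => /(congr1 val); rewrite /= !inordK ?card_rank_set//.
  move=> eab; apply/eqP; apply/negPn/negP => nab.
  have [ab|ba] := rle_total (full_onE a fx) (full_onE b fx).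
    by have := card_rank_set_lt ab nab; rewrite eab ltnn.
  by rewrite eq_sym in nab; have := card_rank_set_lt ba nab; rewrite eab ltnn.
rewrite /insubd insubT/=; first exact/injectiveP.
by move=> h; rewrite -pvalE/= ffunE inordK// card_rank_set.
Qed.

Lemma le_pat x (q r : 'I_k.+1) : full_on x ->
  rle x (c + q%:Z) (c + r%:Z) <-> (pat x q <= pat x r)%N.
Proof.
move=> fx; rewrite !patE//; split=> [qr|].
  have [->//|nqr] := eqVneq q r; exact/ltnW/card_rank_set_lt.
move=> qr; have [//|rq] := rle_total (full_onE q fx) (full_onE r fx).
have [e|nrq] := eqVneq r q.
  by subst r; have [] := rle_total (full_onE q fx) (full_onE q fx).
by have := card_rank_set_lt rq nrq; rewrite ltnNge qr.
Qed.

(** No [full_on] is assumed: even where the default is taken, [pat] is computed from the relation on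
    the window alone. *)
Lemma local_pat h : (absz c + k <= h)%N -> local_fun h pat.
Proof.
move=> ch x y xy; rewrite /pat; congr insubd; apply/ffunP => q.
rewrite !ffunE; congr (inord _); apply: eq_card => p; rewrite !inE; congr (_ && _).
have hp := ltn_ord p; have hq := ltn_ord q.
apply: asbool_equiv_eq; split; apply: (restr_rleE (h := h)) => //; lia.
Qed.

End pattern.

Lemma perm_nondecreasing_id k (f : 'S_k.+1) :
  (forall a b : 'I_k.+1, b = a.+1 :> nat -> (f a <= f b)%N) -> f = 1%g.
Proof.
move=> fS.
(* Injectivity makes [f] strictly increasing; induction from the left end then gives [a <= f a],
   from the right end [f a <= a]. *)
have fS' (a b : 'I_k.+1) : b = a.+1 :> nat -> (f a < f b)%N.
  move=> ab; rewrite ltn_neqAle fS// andbT; apply/eqP => /val_inj/perm_inj e.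
  by move: ab; rewrite e; lia.
have ge n (a : 'I_k.+1) : a = n :> nat -> (n <= f a)%N.
  elim: n a => [//|n IH] a an.
  have nk : (n < k.+1)%N by have := ltn_ord a; lia.
  by have := fS' (Ordinal nk) a an; have := IH (Ordinal nk) erefl; lia.
have le n (a : 'I_k.+1) : (k - a)%N = n -> (f a <= a)%N.
  elim: n a => [|n IH] a an; first by have := ltn_ord a; have := ltn_ord (f a); lia.
  have ak : (a.+1 < k.+1)%N by lia.
  have := fS' a (Ordinal ak) erefl; have := IH (Ordinal ak) => /=.
  by move=> /(_ ltac:(lia)); lia.
apply/permP => a; rewrite perm1; apply/val_inj/eqP.
by rewrite eqn_leq (le _ _ erefl) (ge _ _ erefl).
Qed.

Notation fperm_of tau := (existT (fun n : nat => 'S_n.+1) _ tau).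

(** [occ s] inspects positions from [1 + s] on, so [c - 1] is the offset of the window starting at
    [c]. *)
Lemma occ_full_on c k (tau : 'S_k.+1) x :
  occ (c - 1) (fperm_of tau) x -> full_on c k x.
Proof. by case=> cx _ l hl; apply: cx; rewrite /psize /=; lia. Qed.

(* [occ] lists the positions by increasing value, [pat] the values by position:
   hence the inverse. *)
Lemma occ_pat c k (tau : 'S_k.+1) x : full_on c k x ->
  occ (c - 1) (fperm_of tau^-1%g) x <-> pat c k x = tau.
Proof.
move=> fx; have E (a : 'I_k.+1) : a.+1%:Z + (c - 1) = c + a%:Z by lia.
split=> [[_ H]|e].
  (* The product applies [tau^-1] first: an occurrence says that the ranks increase along the
     positions listed by [tau^-1]. *)
  have : (tau^-1 * pat c k x)%g = 1%g.
    apply: perm_nondecreasing_id => a b ab; rewrite !permM.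
    by apply/(le_pat _ _ fx); rewrite -!E; exact: H.
  by move/(congr1 (fun s => tau * s)%g); rewrite mulKVg mulg1.
split=> [l hl|a b ab]; first by apply: fx; move: hl; rewrite /psize/=; lia.
have ab' : (a <= b)%N by lia.
rewrite /pfun/= !E; apply/(le_pat _ _ fx); rewrite e !permKV.
exact: ab'.
Qed.

Lemma local_occ s pi : local_fun (absz s + psize pi) (occ s pi).
Proof.
have H x y : restr (absz s + psize pi) x = restr (absz s + psize pi) y ->
    occ s pi x -> occ s pi y.
  move=> xy [cx rx]; split=> [l hl|a b ab].
    by apply: (restr_carrierE xy _ (cx _ hl)); lia.
  by apply: (restr_rleE xy _ _ (rx _ _ ab));
    have := ltn_ord (pfun pi a); have := ltn_ord (pfun pi b); lia.
by move=> x y xy; apply/propext; split; apply: H.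
Qed.

(** Taking the root as a plain natural number avoids an index type depending on [s]; [inord] is only
    meaningful for [j] below the size. *)
Definition rooted (s : fperm) (j : nat) : rperm :=
  @root_at s (@inord (tag s) j).

Section rooted_pat.
Variables (h k : nat) (c : int) (x : rperm) (j : nat).
Hypotheses (fx : full_on c k x) (hj : (h <= j)%N) (jk : (j + h <= k)%N).

Lemma carrier_rooted (tau : 'S_k.+1) (l : int) : - h%:Z <= l <= h%:Z ->
  carrier (rooted (fperm_of tau) j) l.
Proof.
by move=> hl; rewrite /rooted/= /root_carrier /psize /= inordK; lia.
Qed.

Lemma rle_rooted_pat (l m : int) : - h%:Z <= l <= h%:Z -> - h%:Z <= m <= h%:Z ->
  rle (rooted (fperm_of (pat c k x)) j) l m <-> rle x (c + j%:Z + l) (c + j%:Z + m).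
Proof.
move=> hl hm; rewrite /rooted/= /root_rle.
have jE : (inord j : 'I_k.+1) = j :> nat by rewrite inordK; lia.
have lk : (absz (j%:Z + l)%R < k.+1)%N by lia.
have mk : (absz (j%:Z + m)%R < k.+1)%N by lia.
have := le_pat (Ordinal lk) (Ordinal mk) fx => /=.
rewrite (_ : c + (absz (j%:Z + l)%R)%:Z = c + j%:Z + l); last by lia.
rewrite (_ : c + (absz (j%:Z + m)%R)%:Z = c + j%:Z + m); last by lia.
move=> ->; split=> [[a [b []]]|le].
  rewrite jE => al bm; rewrite /pfun/=.
  have -> : a = Ordinal lk by apply: val_inj => /=; lia.
  have -> : b = Ordinal mk by apply: val_inj => /=; lia.
  by [].
by exists (Ordinal lk), (Ordinal mk); rewrite jE /=; split=> //; lia.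
Qed.

End rooted_pat.

(* Both sides are the window of radius [h] of [x] around the position [c + j]. *)
Lemma restr_rooted_pat h k k' c c' x j j' :
  full_on c k x -> full_on c' k' x ->
  (h <= j)%N -> (j + h <= k)%N -> (h <= j')%N -> (j' + h <= k')%N ->
  c + j%:Z = c' + j'%:Z ->
  restr h (rooted (fperm_of (pat c k x)) j) = restr h (rooted (fperm_of (pat c' k' x)) j').
Proof.
move=> fx fx' hj jk hj' jk' cj; apply: restr_eqP => [l hl|l m hl hm].
  by split=> _; apply: (carrier_rooted (h := h)).
by rewrite (rle_rooted_pat (h := h))// (rle_rooted_pat (h := h))// cj.
Qed.

Lemma restr_rooted_pat0 h k c x j : full_on c k x ->
  (h <= j)%N -> (j + h <= k)%N -> c + j%:Z = 0 ->
  restr h (rooted (fperm_of (pat c k x)) j) = restr h x.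
Proof.
move=> fx hj jk cj; apply: restr_eqP => [l hl|l m hl hm].
  split=> _; last exact: (carrier_rooted (h := h)).
  by apply: fx; lia.
by rewrite (rle_rooted_pat (h := h))// cj !add0r.
Qed.

(** * Limits of finite permutations are shift-invariant *)

Lemma rooted_ord (s : fperm) (i : 'I_(psize s)) : root_at i = rooted s i.
Proof. by rewrite /rooted inord_val. Qed.

Lemma leq_sum_shift N (b : int -> bool) (s t : int) :
  (\sum_(j < N) b (j%:Z + s)%R <= \sum_(j < N) b (j%:Z + t)%R + absz (s - t)%R)%N.
Proof.
(* [f u] counts the hits of [b] in [u, u + N - 1]. Moving this window by one drops one end and gains
   the other, so each unit of shift changes the count by at most one. *)
pose f u := (\sum_(j < N) b (j%:Z + u)%R)%N.
have step u : (f u + b (N%:Z + u)%R = b u + f (u + 1)%R)%N.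
  rewrite /f -[in LHS](big_mkord xpredT (fun j => nat_of_bool (b (j%:Z + u)%R))).
  rewrite -(big_nat_recr N 0 (fun j => nat_of_bool (b (j%:Z + u)%R)))//.
  rewrite big_nat_recl// big_mkord add0r; congr (_ + _)%N.
  by apply: eq_bigr => j _; congr (nat_of_bool (b _)); lia.
have H n u : (f u <= f (u + n%:Z)%R + n)%N /\ (f (u + n%:Z)%R <= f u + n)%N.
  elim: n => [|n [IH1 IH2]]; first by rewrite addr0 addn0.
  have := step (u + n%:Z)%R.
  rewrite (_ : u + n%:Z + 1 = u + n.+1%:Z)%R; last by lia.
  by case: (b _); case: (b _); lia.
rewrite -/(f s) -/(f t); have [st|ts] := leP s t.
  by have [+ _] := H (absz (s - t)) s; rewrite (_ : s + _ = t)%R//; lia.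
by have [_ +] := H (absz (s - t)) t; rewrite (_ : t + _ = s)%R//; lia.
Qed.

Lemma occ_rooted_shift (s pi : fperm) : exists b : int -> bool,
  forall (t : int) (j : nat), (j < psize s)%N ->
    `[< occ t pi (rooted s j) >] = b (j%:Z + t).
Proof.
(* The occurrence in absolute coordinates of [s]: root and offset enter only through the sum
   [j + t], so moving the offset amounts to moving the root. *)
pose Q u := (forall l, 1 + u <= l <= (psize pi)%:Z + u -> 0 <= l < (psize s)%:Z) /\
  forall a b : 'I_(psize pi), b = a.+1 :> nat ->
  exists p q : 'I_(psize s), [/\ p%:Z = (pfun pi a).+1%:Z + u,
    q%:Z = (pfun pi b).+1%:Z + u & (pfun s p <= pfun s q)%N].
exists (fun u => `[< Q u >]) => t j js; apply: asbool_equiv_eq.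
have jE : (@inord (tag s) j) = j :> nat by rewrite inordK.
rewrite /occ /rooted /= /root_carrier /root_rle/= jE; split=> -[c r]; split.
- by move=> l hl; have := c (l - j%:Z) ltac:(lia); lia.
- by move=> a b /r[p [q [pE qE pq]]]; exists p, q; split=> //; lia.
- by move=> l hl; have := c (l + j%:Z) ltac:(lia); lia.
- by move=> a b /r[p [q [pE qE pq]]]; exists p, q; split=> //; lia.
Qed.

(** * Conditioning on the value of the finite permutation *)

Section fibers.
Variable R : realType.
Context d (T : measurableType d) (P : probability T R).
Variables (sigma : {RV P >-> fperm}) (i : forall w, 'I_(psize (sigma w))).
Hypothesis ui : uniform_index i.
Local Open Scope ereal_scope.

Lemma measurable_sigma (B : set fperm) : measurable (sigma @^-1` B).
Proof. by rewrite -[sigma @^-1` B]setTI; exact: (measurable_funP sigma). Qed.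

Lemma measurable_uniform_index (B : fperm -> nat -> Prop) :
  measurable [set w | B (sigma w) (i w)].
Proof.
rewrite (_ : [set w | _] = \bigcup_j
    (sigma @^-1` [set s | B s j] `&` [set w | (i w : nat) = j])); last first.
  apply/seteqP; split=> [w /= Bw|w [j _ [/= Bj wj]]]; last by rewrite wj.
  by exists (i w).
apply: bigcupT_measurable => j; apply: measurableI; first exact: measurable_sigma.
by rewrite -[X in measurable X]setTI; exact: (ui.1 measurableT [set j]).
Qed.

(** [A] may be any set, because the rooted permutation factors through the discrete data of a
    permutation and an index. *)
Lemma measurable_root_at (A : set rperm) :
  measurable ((fun w => root_at (i w)) @^-1` A).
Proof.
rewrite (_ : _ @^-1` A = [set w | A (rooted (sigma w) (i w))]).
  exact: (measurable_uniform_index (fun s j => A (rooted s j))).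
by apply/seteqP; split=> w /=; rewrite rooted_ord.
Qed.

(** Given [sigma = s], the root is uniform, so the conditional probability of [A] is the proportion
    of roots of [s] satisfying [A]. *)
Lemma prob_fiber (A : set rperm) (s : fperm) :
  P ((fun w => root_at (i w)) @^-1` A `&` [set w | sigma w = s]) =
  P [set w | sigma w = s] *
  (((\sum_(j < psize s) `[< A (rooted s j) >])%N%:R / (psize s)%:R : R)%R)%:E.
Proof.
pose F j := [set w | [/\ sigma w = s, (i w : nat) = j & A (rooted s j)]].
rewrite (_ : _ `&` _ = \big[setU/set0]_(j < psize s) F j); last first.
  rewrite -bigcup_mkord; apply/seteqP; split=> w /=.
    move=> [+ sw]; rewrite rooted_ord (congr1 (rooted^~ (i w : nat)) sw) => Aw.
    by exists (i w : nat); [rewrite /= -sw ltn_ord|].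
  move=> [j js [sw <- Aw]]; split=> //.
  by rewrite rooted_ord (congr1 (rooted^~ (i w : nat)) sw).
rewrite measure_bigsetU; last 2 first.
- by move=> j; exact: (measurable_uniform_index
    (fun s' k => [/\ s' = s, k = j & A (rooted s j)])).
- by apply/trivIsetP => j k _ _ jk; apply/seteqP; split=> // w [[_ wj _] [_ wk _]];
    rewrite -wj -wk eqxx in jk.
have PF j : (j < psize s)%N -> P (F j) = P [set w | sigma w = s] *
    ((`[< A (rooted s j) >]%:R / (psize s)%:R : R)%R)%:E.
  move=> js; case: asboolP => Aj.
    rewrite mul1r -(ui.2 s j)//; congr (P _).
    by apply/seteqP; split=> w [].
  rewrite mul0r mule0 (_ : F j = set0) ?measure0//.
  by apply/seteqP; split=> // w -[].
rewrite (eq_bigr _ (fun (j : 'I_(psize s)) _ => PF j (ltn_ord j))).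
have fs : P [set w | sigma w = s] \is a fin_num.
  by apply: fin_num_measure; exact: (measurable_sigma [set s]).
rewrite -(fineK fs); under eq_bigr do rewrite -EFinM.
by rewrite sumEFin -EFinM; congr EFin; rewrite -mulr_sumr -mulr_suml natr_sum.
Qed.

(** There are countably many finite permutations; numbering them turns the sum over fibers into a
    series indexed by naturals. *)
Let code (s : fperm) : nat := pickle (s : {n : nat & 'S_n.+1}).

Lemma prob_fibers (A : set T) : measurable A ->
  P A = \sum_(k <oo) P (A `&` [set w | code (sigma w) = k]).
Proof.
move=> mA; have AE : A = \bigcup_k (A `&` [set w | code (sigma w) = k]).
  by apply/seteqP; split=> [w Aw|w [k _ []]//]; exists (code (sigma w)).
rewrite {1}AE measure_bigcup.
- by apply: eq_eseriesl => k; rewrite in_setT.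
- by move=> k _; apply: measurableI => //;
    exact: (measurable_sigma [set s | code s = k]).
- by apply/trivIsetP => j k _ _ jk; apply/seteqP; split=> // w [[_ /= wj] [_ /= wk]];
    rewrite -wj -wk eqxx in jk.
Qed.

Lemma prob_occ_shift (pi : fperm) (s t : int) (m : nat) : (0 < m)%N ->
  P ((fun w => root_at (i w)) @^-1` occ s pi) <=
  P ((fun w => root_at (i w)) @^-1` occ t pi) +
  (P [set w | (psize (sigma w) <= m)%N] + ((absz (s - t))%:R / m%:R : R)%R%:E).
Proof.
move=> m0; have mO u : measurable ((fun w => root_at (i w)) @^-1` occ u pi).
  exact: measurable_root_at.
have mS : measurable [set w | (psize (sigma w) <= m)%N].
  exact: (measurable_sigma [set s | (psize s <= m)%N]).
set r : R := (_ / _)%R; have r0 : (0 <= r)%R by rewrite /r divr_ge0.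
(* The constant [r] becomes [r] times the total mass, so that all terms split over the fibers and
   the inequality can be checked on each. *)
rewrite -[r%:E]mule1 -(probability_setT P).
rewrite (prob_fibers (mO s)) (prob_fibers (mO t)) (prob_fibers mS).
rewrite (prob_fibers measurableT) -nneseriesZl// -nneseriesD//; last first.
  by move=> k _ _; rewrite mule_ge0.
rewrite -nneseriesD//; last by move=> k _ _; rewrite adde_ge0// mule_ge0.
apply: lee_nneseries => // k _.
have [[w0 w0k]|nk] := pselect (exists w, code (sigma w) = k); last first.
  rewrite (_ : _ `&` _ = set0) ?measure0 ?adde_ge0// ?mule_ge0//.
  by apply/seteqP; split=> // w [_ /= wk]; apply: nk; exists w.
set s0 := sigma w0.
have -> : [set w | code (sigma w) = k] = [set w | sigma w = s0].
  apply/seteqP; split=> w /=; last by move=> ->.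
  rewrite -w0k => /(pcan_inj (@pickleK {n : nat & 'S_n.+1})); exact.
rewrite !prob_fiber setTI.
(* A small fiber is absorbed by the probability of having size at most [m]. On a large one the two
   counts differ by at most [|s - t|], out of more than [m] roots. *)
have [sm|ms] := leqP (psize s0) m.
  rewrite (_ : [set w | (psize (sigma w) <= m)%N] `&` [set w | sigma w = s0] = [set w | sigma w = s0]); last first.
    by apply/seteqP; split=> [w []//|w /= e]; split=> //=; rewrite e.
  apply: le_trans (_ : P [set w | sigma w = s0] <= _).
    rewrite -[leRHS]mule1 lee_wpmul2l// lee_fin ler_pdivrMr ?ltr0n//.
    rewrite mul1r ler_nat -[leqRHS]card_ord -sum1_card.
    by apply: leq_sum => j _; case: asbool.
  by rewrite addeCA leeDl// adde_ge0 ?mule_ge0//.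
rewrite (_ : [set w | (psize (sigma w) <= m)%N] `&` [set w | sigma w = s0] = set0); last first.
  by apply/seteqP; split=> // w [/= + e]; rewrite e leqNgt ms.
have fs : P [set w | sigma w = s0] \is a fin_num.
  by apply: fin_num_measure; exact: (measurable_sigma [set s0]).
rewrite measure0 add0e -(fineK fs) -!EFinM -EFinD lee_fin.
rewrite [(r * _)%R]mulrC -mulrDr ler_wpM2l ?fine_ge0//.
have [b bE] := occ_rooted_shift s0 pi.
have E u : (\sum_(j < psize s0) `[< occ u pi (rooted s0 j) >])%N =
    (\sum_(j < psize s0) b (j%:Z + u)%R)%N.
  by apply: eq_bigr => j _; rewrite bE.
rewrite !E ler_pdivrMr ?ltr0n// mulrDl divfK ?pnatr_eq0//.
apply: le_trans (_ : _ <= (\sum_(j < psize s0) b (j%:Z + t)%R + absz (s - t)%R)%N%:R)%R _.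
  by rewrite ler_nat leq_sum_shift.
rewrite natrD lerD2l /r -mulrA ler_peMr// mulrC ler_pdivlMr ?ltr0n//.
by rewrite mul1r ler_nat ltnW.
Qed.

End fibers.

(** * Passage to the limit *)

Section limit_shift_invariant.
Variable R : realType.
Context d0 (T0 : measurableType d0) (P0 : probability T0 R).
Variable X : {RV P0 >-> rpermB R}.
Context (d : nat -> measure_display) (T : forall n, measurableType (d n)).
Variables (P : forall n, probability (T n) R) (sigma : forall n, {RV (P n) >-> fperm}).
Variable i : forall n w, 'I_(psize (sigma n w)).
Local Open Scope ereal_scope.

(** The indicator of a local event is bounded and locally constant, hence an admissible test
    function. *)
Lemma annealed_BS_cvg_local h (A : set rperm) : annealed_BS_cvg i X ->
  (0 < h)%N -> local_fun h A ->
  P n ((fun w => root_at (@i n w)) @^-1` A) @[n --> \oo] --> P0 (X @^-1` A).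
Proof.
move=> [ui /(_ (\1_A : rpermM R -> R))cv] h0 hA.
have E e (U : measurableType e) (Q : probability U R) (Y : U -> rperm) :
    measurable (Y @^-1` A) -> 'E_Q[(\1_A : rpermM R -> R) \o Y] = Q (Y @^-1` A).
  by move=> mA; rewrite -(expectation_indic Q mA); congr expectation.
rewrite -(E _ _ _ X); last exact: measurable_preimage_local hA.
have -> : (fun n => P n ((fun w => root_at (@i n w)) @^-1` A)) =
    (fun n => 'E_(P n)[(\1_A : rpermM R -> R) \o (fun w => root_at (@i n w))]).
  by apply/funext => n; rewrite E//; exact: measurable_root_at.
apply: cv.
- apply: (local_continuous h0) => x y xy.
  by rewrite !indicE (_ : (x \in A) = (y \in A))//;
    apply/idP/idP; rewrite !inE (hA _ _ xy).
- by exists 1%R => x; rewrite indicE ger0_norm// lern1 leq_b1.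
Qed.

(** Otherwise the carrier, an interval around 0, would lie strictly between [-m] and [m]. *)
Lemma infinite_carrier (x : rperm) (m : nat) : infinite_rperm x ->
  carrier x m%:Z \/ carrier x (- m%:Z)%R.
Proof.
move=> inf; apply: contrapT => /not_orP[nm nN]; apply: inf.
apply: (@sub_finite_set _ _ ((fun k : nat => k%:Z - m%:Z)%R @` `I_(m + m))); last first.
  exact/finite_image/finite_II.
move=> l xl; have c0 := carrier0 x.
have lm : (l < m%:Z)%R.
  by rewrite ltNge; apply/negP => ml; apply: nm; apply: (carrier_itv c0 xl); lia.
have Nml : (- m%:Z < l)%R.
  by rewrite ltNge; apply/negP => ml; apply: nN; apply: (carrier_itv xl c0); lia.
by exists (absz (l + m%:Z)%R) => /=; lia.
Qed.

Lemma limit_occ_le (pi : fperm) (s t : int) :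
  (forall w, infinite_rperm (X w)) -> annealed_BS_cvg i X ->
  P0 (X @^-1` occ s pi) <= P0 (X @^-1` occ t pi).
Proof.
move=> inf cv; have occ_cvg u : P n ((fun w => root_at (@i n w)) @^-1` occ u pi) @[n --> \oo] -->
    P0 (X @^-1` occ u pi).
  by apply: annealed_BS_cvg_local cv _ (@local_occ u pi); rewrite addn_gt0 orbT.
apply/lee_addgt0Pr => e e0.
have [m m0 me] : exists2 m : nat, (0 < m)%N & ((absz (s - t))%:R / m%:R <= e)%R.
  exists (Num.truncn ((absz (s - t))%:R / e)).+1 => //.
  rewrite ler_pdivrMr ?ltr0n// mulrC -ler_pdivrMr//.
  by rewrite ltW// truncnS_gt.
(* A local event that holds at every root of a permutation of size at most [m] and is empty for [X]
   by [infinite_carrier]. Its limit probability 0 shows that small sizes become negligible. *)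
pose B : set rperm := [set x | ~ (carrier x m%:Z \/ carrier x (- m%:Z)%R)].
have BL : local_fun m.+1 B.
  suff H x y : restr m.+1 x = restr m.+1 y -> B x -> B y.
    by move=> x y xy; apply/propext; split; apply: H.
  move=> xy Bx [ym|ym]; apply: Bx; [left|right];
    by apply: (restr_carrierE (esym xy) _ ym); lia.
have B0 : P n ((fun w => root_at (@i n w)) @^-1` B) @[n --> \oo] --> 0.
  rewrite -(measure0 P0).
  have := annealed_BS_cvg_local cv _ BL; rewrite (_ : X @^-1` B = set0); first exact.
  by apply/seteqP; split=> // w /=; have := infinite_carrier m (inf w); rewrite /B/=; tauto.
have cR : P n ((fun w => root_at (@i n w)) @^-1` occ t pi) +
    (P n ((fun w => root_at (@i n w)) @^-1` B) + e%:E) @[n --> \oo] -->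
    P0 (X @^-1` occ t pi) + (0 + e%:E).
  apply: cvgeD (occ_cvg t) _; first by rewrite add0e fin_num_adde_defl.
  by apply: cvgeD B0 (cvg_cst _); rewrite fin_num_adde_defl.
rewrite -[e%:E]add0e; apply: (lee_cvg_to (occ_cvg s) cR).
apply: nearW => n /=; have ui := cv.1 n.
apply: (le_trans (prob_occ_shift ui pi s t m0)).
rewrite leeD2l// leeD ?lee_fin//; apply: le_measure; rewrite ?inE.
- exact: (measurable_sigma (sigma n) [set s | (psize s <= m)%N]).
- exact: measurable_root_at.
move=> w /= wm; rewrite /root_carrier /B/= /root_carrier /= => -[]; have := ltn_ord (@i n w); lia.
Qed.

Lemma limit_shift_invariant :
  (forall w, infinite_rperm (X w)) -> annealed_BS_cvg i X -> shift_invariant X.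
Proof.
by move=> inf cv pi s; apply/eqP; rewrite eq_le !limit_occ_le.
Qed.

End limit_shift_invariant.

(** * Shift-invariant permutations are limits *)

(** Through the pattern of size one, shift-invariance gives information on the carrier. *)
Lemma occ1E (l : int) x : occ (l - 1) (fperm_of (1%g : 'S_1)) x <-> carrier x l.
Proof.
split=> [/occ_full_on fx|xl]; first by apply: fx; lia.
split=> [m hm|a b]; last by rewrite (ord1 a) (ord1 b).
by rewrite (_ : m = l)//; move: hm; rewrite /psize/=; lia.
Qed.

Section shift_invariant_patterns.
Variable R : realType.
Context d (T : measurableType d) (P : probability T R).
Variable X : {RV P >-> rpermB R}.
Hypothesis sX : shift_invariant X.
Local Open Scope ereal_scope.

Lemma measurable_occ s pi : measurable (X @^-1` occ s pi).
Proof.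
by apply: measurable_preimage_local (@local_occ s pi); rewrite addn_gt0 orbT.
Qed.

Lemma ae_carrier (l : int) : {ae P, forall w, carrier (X w) l}.
Proof.
pose O l := X @^-1` occ (l - 1)%R (fperm_of (1%g : 'S_1)).
have PO : P (O l) = 1.
  (* The offset [l - 1] is moved to [0] and then to [-1], where the event says that 0 lies in the
     carrier. *)
  rewrite /O sX -(sX _ (0 - 1)%R) -(probability_setT P); congr (P _).
  by apply/seteqP; split=> // w _; apply/occ1E; exact: carrier0.
exists (~` O l); split.
- by apply: measurableC; exact: measurable_occ.
- by rewrite probability_setC ?PO ?subee//; exact: measurable_occ.
- by move=> w /= nl /occ1E.
Qed.

Lemma ae_full : {ae P, forall w, forall c k, full_on c k (X w)}.
Proof.
have : {ae P, forall w, forall n : nat, carrier (X w) n%:Z /\ carrier (X w) (- n%:Z)%R}.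
  by apply/ae_foralln => n; apply: filterI; exact: ae_carrier.
apply: filterS => w H c k l _.
by have [] := H (absz l); have [l0|l0] := leP 0%R l;
  [rewrite (_ : (absz l)%:Z = l)%R; last lia | rewrite (_ : - (absz l)%:Z = l)%R; last lia].
Qed.

Lemma measurable_local_comp h (g : rpermM R -> R) : (0 < h)%N ->
  local_fun h g -> measurable_fun [set: T] (g \o X).
Proof. by move=> h0 /(local_continuous h0); exact: measurable_continuous_comp. Qed.

(** The right-hand side is free of [c]: the law of the pattern of [X] on a window depends only on
    its length. Almost surely exactly one of the events [O tau] occurs. *)
Lemma integral_pat c k (G : 'S_k.+1 -> R) : (forall tau, 0 <= G tau)%R ->
  \int[P]_w (G (pat c k (X w)))%:E =
  \sum_(tau : 'S_k.+1) (G tau)%:E * P (X @^-1` occ 0 (fperm_of tau^-1%g)).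
Proof.
move=> G0; pose O (tau : 'S_k.+1) : set T := X @^-1` occ (c - 1)%R (fperm_of tau^-1%g).
have mO tau : measurable (O tau) by exact: measurable_occ.
have mI tau : measurable_fun [set: T] (fun w => (G tau)%:E * (\1_(O tau) w)%:E).
  by apply: measurable_funeM; apply/measurable_EFinP; exact: measurable_indic.
transitivity (\int[P]_w \sum_(tau : 'S_k.+1) (G tau)%:E * (\1_(O tau) w)%:E).
  apply: ae_eq_integral => //.
  - apply/measurable_EFinP.
    apply: (@measurable_local_comp (absz c + k).+1 (fun x => G (pat c k x))) => //.
    by move=> x y xy; congr G; apply: local_pat xy; lia.
  - exact: emeasurable_sum.
  apply: filterS ae_full => w fw _; rewrite (bigD1 (pat c k (X w)))//= big1 ?adde0.
    by rewrite indicE mem_set ?mule1//; apply/(occ_pat _ (fw c k)).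
  move=> tau ntau; rewrite indicE memNset ?mule0// => /(occ_pat _ (fw c k)) e.
  by rewrite e eqxx in ntau.
rewrite ge0_integral_sum//; last first.
  by move=> tau w _; rewrite mule_ge0 ?lee_fin ?indicE.
apply: eq_bigr => tau _; rewrite ge0_integralZl//.
- by rewrite integral_indic ?setIT; [congr (_ * _); exact: sX| |exact: mO].
- by apply/measurable_EFinP; exact: measurable_indic.
- by rewrite lee_fin.
Qed.

(* Seen from a position [j] at distance at least [h] from the boundary, the
   window of radius [h] in the pattern of [X] on [0, n] has the law of the
   window of [X] around the root. *)
Lemma integral_rooted_pat h (g : rpermM R -> R) n j : (0 < h)%N ->
  local_fun h g -> (forall x, 0 <= g x)%R -> (h <= j)%N -> (j + h <= n)%N ->
  \int[P]_w (g (rooted (fperm_of (pat 0 n (X w))) j))%:E =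
  \int[P]_w (g (X w))%:E.
Proof.
move=> h0 gL g0 hj jn.
pose G (tau : 'S_(h + h).+1) := g (rooted (fperm_of tau) h).
have mpat c k i : measurable_fun [set: T]
    (fun w => (g (rooted (fperm_of (pat c k (X w))) i))%:E).
  apply/measurable_EFinP.
  apply: (@measurable_local_comp (absz c + k).+1
    (fun x => g (rooted (fperm_of (pat c k x)) i))) => // x y xy.
  by rewrite (@local_pat c k (absz c + k).+1 (leqnSn _) _ _ xy).
(* The pattern on [0, n] is first cut down to [j - h, j + h], rooted at index [h]; [integral_pat]
   then moves this window to [-h, h]. *)
transitivity (\int[P]_w (G (pat (j%:Z - h%:Z)%R (h + h) (X w)))%:E).
  apply: ae_eq_integral; [by []|exact: mpat|exact: mpat|].
  apply: filterS ae_full => w fw _; congr EFin.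
  by apply: gL; apply: restr_rooted_pat => //; lia.
rewrite integral_pat; last by move=> tau; exact: g0.
rewrite -(integral_pat (- h%:Z)%R); last by move=> tau; exact: g0.
apply: ae_eq_integral; [by []|exact: mpat| |].
  by apply/measurable_EFinP; exact: measurable_local_comp gL.
apply: filterS ae_full => w fw _; congr EFin.
by apply: gL; apply: restr_rooted_pat0 => //; lia.
Qed.

End shift_invariant_patterns.

(** * Uniform mixtures of laws *)

Section average.
Variable R : realType.
Context d d' (T : measurableType d) (T' : measurableType d').
Variables (P : probability T R) (f : nat -> {mfun T >-> T'}) (n : nat).
Local Open Scope ereal_scope.

(** The law of [f J] for an independent [J] uniform on {0, ..., n}. *)
Definition average : set T' -> \bar R :=
  mscale (n.+1%:R^-1)%:nng%R (msum (fun j => distribution P (f j)) n.+1).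

HB.instance Definition _ := Measure.on average.

Lemma averageE (A : set T') :
  average A = ((n.+1%:R^-1 : R)%R)%:E * \sum_(j < n.+1) P (f j @^-1` A).
Proof. by []. Qed.

Lemma average_setT : average [set: T'] = 1.
Proof.
rewrite averageE; under eq_bigr do rewrite preimage_setT probability_setT.
by rewrite sumEFin sumr_const card_ord -EFinM mulVf.
Qed.

HB.instance Definition _ := Measure_isProbability.Build _ _ _ average average_setT.

Lemma ge0_integral_average (g : T' -> \bar R) :
  measurable_fun [set: T'] g -> (forall x, 0 <= g x) ->
  \int[average]_x g x = ((n.+1%:R^-1 : R)%R)%:E * \sum_(j < n.+1) \int[P]_w g (f j w).
Proof.
move=> mg g0; rewrite ge0_integral_mscale// ge0_integral_measure_sum//=.
congr (_ * _); apply: eq_bigr => j _.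
by rewrite ge0_integral_pushforward.
Qed.

End average.

(** The sample space for the approximating sequence: it carries permutation and root together, and
    being discrete makes every map out of it measurable. *)
Definition rooted_fperm : Type := {s : fperm & 'I_(psize s)}.

HB.instance Definition _ := Choice.on rooted_fperm.
HB.instance Definition _ :=
  isPointed.Build rooted_fperm (existT (fun s => 'I_(psize s)) point ord0).
HB.instance Definition _ := @isMeasurable.Build default_measure_display
  rooted_fperm discrete_measurable discrete_measurable0
  discrete_measurableC discrete_measurableU.

Lemma measurable_fun_rooted_fperm d (T : measurableType d) (f : rooted_fperm -> T) :
  measurable_fun [set: rooted_fperm] f.
Proof. by []. Qed.

Definition tag_fperm (q : rooted_fperm) : fperm := tag q.

HB.instance Definition _ := @isMeasurableFun.Build _ _ rooted_fperm fperm
  tag_fperm (measurable_fun_rooted_fperm tag_fperm).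

Definition tag_index (q : rooted_fperm) : 'I_(psize (tag_fperm q)) := tagged q.

(** * The pattern of [X] on [0, n] with a uniform root *)

Section sampled_pattern.
Variable R : realType.
Context d (T : measurableType d) (P : probability T R).
Variable X : {RV P >-> rpermB R}.
Local Open Scope ereal_scope.

Definition sample (n j : nat) (w : T) : rooted_fperm :=
  existT (fun s => 'I_(psize s)) (fperm_of (pat 0 n (X w))) (inord j : 'I_n.+1).

Lemma measurable_sample n j : measurable_fun [set: T] (sample n j).
Proof.
move=> _ B _; rewrite setTI.
pose A x := B (existT (fun s => 'I_(psize s)) (fperm_of (pat 0 n x)) (inord j : 'I_n.+1)).
apply: (measurable_preimage_local X (A := A) (ltn0Sn n)) => x y xy; rewrite /A.
by rewrite (@local_pat 0 n n.+1 (leqnSn _) _ _ xy).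
Qed.

HB.instance Definition _ n j := @isMeasurableFun.Build _ _ T rooted_fperm
  (sample n j) (measurable_sample n j).

Definition sample_law (n : nat) : probability rooted_fperm R :=
  average P (fun j => sample n j) n.

Definition sample_fperm (n : nat) : {RV (sample_law n) >-> fperm} := tag_fperm.

Lemma sample_lawE n (A : set rooted_fperm) : sample_law n A =
  ((n.+1%:R^-1 : R)%R)%:E * \sum_(j < n.+1) P (sample n j @^-1` A).
Proof. exact: averageE. Qed.

Lemma sample_law_fiber n (s : fperm) (A : set rooted_fperm) : tag s != n ->
  sample_law n ([set q | tag_fperm q = s] `&` A) = 0.
Proof.
move=> ns; rewrite sample_lawE big1 ?mule0// => k _.
rewrite (_ : _ @^-1` _ = set0) ?measure0//; apply/seteqP; split=> // w [/= e _].
by rewrite -e eqxx in ns.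
Qed.

Lemma uniform_sample n : uniform_index (sigma := sample_fperm n) tag_index.
Proof.
split=> // s j js.
have [sn|ns] := eqVneq (tag s) n; last first.
  have -> : [set w | sample_fperm n w = s] = [set q | tag_fperm q = s] `&` setT.
    by rewrite setIT.
  by rewrite !sample_law_fiber// mul0e.
rewrite !sample_lawE.
(* Both sides equal [P F / (n + 1)]: only the [j]-th summand contributes to the joint event, while
   all [n + 1] contribute [P F] to the law of the permutation. *)
pose F := [set w | fperm_of (pat 0 n (X w)) = s].
have jn : (j < n.+1)%N by rewrite -sn.
rewrite (bigD1 (Ordinal jn))//= big1 ?adde0 => [|k kj]; last first.
  rewrite (_ : _ @^-1` _ = set0) ?measure0//; apply/seteqP; split=> // w [/= _].
  by rewrite inordK// => e; move/negP: kj; apply; apply/eqP/val_inj.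
rewrite (eq_bigr (fun=> P F))//.
rewrite (_ : _ @^-1` _ = F); last first.
  by apply/seteqP; split=> [w [/= e _]//|w e]; split=> //=; rewrite inordK.
have mF : measurable F.
  rewrite (_ : F = sample n 0 @^-1` [set q | tag_fperm q = s])//.
  by rewrite -[X in measurable X]setTI; exact: measurable_sample.
rewrite /psize sn -(fineK (fin_num_measure P _ mF)) sumEFin sumr_const card_ord -!EFinM.
congr EFin; rewrite -[(fine _ *+ _)%R]mulr_natr [(_^-1 * (_ * _))%R]mulrC.
by rewrite mulfK ?pnatr_eq0// mulrC.
Qed.

(** The [n + 1 - 2h] roots with [h <= j <= n - h] each contribute the integral of [g] at [X]; the
    boundary terms are dropped since [g >= 0]. The truncated subtraction gives 0 when there are no
    such roots. *)
Lemma le_integral_sample h (g : rpermM R -> R) n : shift_invariant X ->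
  (0 < h)%N -> local_fun h g -> (forall x, 0 <= g x)%R ->
  (((n.+1 - h - h)%N%:R / n.+1%:R : R)%R)%:E * \int[P]_w (g (X w))%:E <=
  \int[sample_law n]_q (g (root_at (tag_index q)))%:E.
Proof.
move=> sX h0 gL g0; set I := \int[P]_w _.
have I0 : 0 <= I by apply: integral_ge0 => w _; rewrite lee_fin.
rewrite ge0_integral_average//; last first.
  by move=> q; rewrite lee_fin.
rewrite mulrC EFinM -muleA lee_wpmul2l ?lee_fin//.
pose a j := \int[P]_w (g (rooted (fperm_of (pat 0 n (X w))) j))%:E.
rewrite (eq_bigr (fun j : 'I_n.+1 => a j)); last first.
  move=> j _; apply: eq_integral => w _; rewrite rooted_ord.
  by rewrite /= inordK.
have [hn|nh] := leqP (h + h) n.+1; last first.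
  rewrite (_ : (n.+1 - h - h)%N = 0%N) ?mul0e; last by lia.
  by apply: sume_ge0 => j _; apply: integral_ge0 => w _; rewrite lee_fin.
rewrite -(big_mkord xpredT) (big_cat_nat (n := h))//=; last by lia.
rewrite [X in _ + X](big_cat_nat (n := (n.+1 - h)%N))//=; [|lia|lia].
have a0 m p : 0 <= \sum_(m <= j < p) a j.
  by apply: sume_ge0 => j _; apply: integral_ge0 => w _; rewrite lee_fin.
rewrite addeCA; apply: le_trans (leeDl _ _); last by rewrite adde_ge0.
rewrite big_nat (eq_bigr (fun=> I)); last first.
  by move=> j hj; apply: (integral_rooted_pat sX h0 gL g0); lia.
by rewrite -big_nat sumr_const_nat mule_natl.
Qed.

End sampled_pattern.

(** * Local approximation of a nonnegative function from below *)

Section local_inf.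
Variables (R : realType) (f : rpermM R -> R).
Hypothesis f0 : forall x, 0 <= f x.

Definition local_inf (h : nat) (x : rpermM R) : R :=
  inf [set f y | y in [set y | restr h x = restr h y]].

Lemma local_local_inf h : local_fun h (local_inf h).
Proof. by move=> x y; rewrite /local_inf => ->. Qed.

Lemma le_local_inf (a : R) h x :
  (forall y, restr h x = restr h y -> a <= f y) -> a <= local_inf h x.
Proof. by move=> H; apply: lb_le_inf; [exists (f x), x|move=> _ [y /H ay <-]]. Qed.

Lemma local_inf_ge0 h x : 0 <= local_inf h x.
Proof. by apply: le_local_inf => y _. Qed.

Lemma local_inf_le h x y : restr h x = restr h y -> local_inf h x <= f y.
(* Nonnegativity of [f] supplies the lower bound that keeps [inf] from its default value. *)
Proof. by move=> xy; apply: ge_inf; [exists 0 => _ [z _ <-]|exists y]. Qed.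

Lemma local_inf_nondecreasing g h x : (0 < g <= h)%N ->
  local_inf g x <= local_inf h x.
Proof.
move=> gh; apply: le_local_inf => y xy; apply: local_inf_le.
by apply: (agree_le gh _).2; split=> //; case/andP: gh => g0; exact: leq_trans.
Qed.

Lemma cvg_local_inf x : continuous f -> local_inf h.+1 x @[h --> \oo] --> f x.
Proof.
move=> cf; apply/cvgrPdist_le => e e0.
have /nbhs_restr_sub[h h0 hP] : nbhs x [set y | `|f x - f y| <= e].
  by have /cvgrPdist_le := cf x; exact.
near=> k; have fx : local_inf k.+1 x <= f x by exact: local_inf_le.
rewrite ger0_norm ?subr_ge0// lerBlDr -lerBlDl.
apply: le_trans (_ : local_inf h x <= _).
  by apply: le_local_inf => y /hP /=; rewrite ler_norml => /andP[_]; lra.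
apply: local_inf_nondecreasing; rewrite h0/=.
by apply: leqW; near: k; exact: nbhs_infty_ge.
Unshelve. all: by end_near. Qed.

End local_inf.

(** * Expectations of bounded functions *)

Section bounded_integral.
Variable R : realType.
Context d (T : measurableType d) (P : probability T R).
Variables (f : T -> R) (M : R).
Hypotheses (mf : measurable_fun [set: T] f) (fM : forall x, `|f x| <= M).

Lemma bounded_integrable : P.-integrable [set: T] (EFin \o f).
Proof.
apply: measurable_bounded_integrable => //.
  by rewrite (le_lt_trans (probability_le1 _ measurableT))// ltry.
exists M; split; first exact: num_real.
by move=> K MK x _; exact: le_trans (fM x) (ltW MK).
Qed.

Lemma bounded_integralE : (\int[P]_x (f x)%:E)%E = (\int[P]_x f x)%:E.
Proof. by rewrite fineK// integrable_fin_num//; exact: bounded_integrable. Qed.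

Let integrable_M : P.-integrable [set: T] (EFin \o cst M).
Proof. exact: finite_measure_integrable_cst. Qed.

Lemma bounded_integralD : (\int[P]_x (f x + M)%:E)%E = (\int[P]_x f x + M)%:E.
Proof.
under eq_integral do rewrite EFinD.
rewrite (integralD_EFin _ bounded_integrable integrable_M)//= bounded_integralE.
by rewrite integral_cst//= probability_setT mule1.
Qed.

Lemma bounded_integralB : (\int[P]_x (M - f x)%:E)%E = (M - \int[P]_x f x)%:E.
Proof.
under eq_integral do rewrite EFinB.
rewrite (integralB_EFin _ integrable_M bounded_integrable)//= bounded_integralE.
by rewrite integral_cst//= probability_setT mule1.
Qed.

End bounded_integral.

(** * Convergence in distribution of the sampled patterns *)

Section sample_cvg.
Variable R : realType.
Context d (T : measurableType d) (P : probability T R).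
Variable X : {RV P >-> rpermB R}.
Hypothesis sX : shift_invariant X.

(** An epsilon form of the liminf bound. Half of [e] pays for replacing [f] by a local infimum
    (monotone convergence), the other half for the boundary roots. *)
Lemma near_le_integral_sample (f : rpermM R -> R) (e : R) : continuous f ->
  (forall x, 0 <= f x) -> (\int[P]_w (f (X w))%:E)%E \is a fin_num -> 0 < e ->
  \forall n \near \oo, (\int[P]_w (f (X w))%:E <=
    \int[sample_law X n]_q (f (root_at (tag_index q)))%:E + e%:E)%E.
Proof.
move=> cf f0 fL e0; pose g h w : \bar R := (local_inf f h.+1 (X w))%:E.
have mg h : measurable_fun [set: T] (g h).
  by apply/measurable_EFinP; apply: measurable_local_comp (@local_local_inf _ f h.+1).
have g0 h w : (0 <= g h w)%E by rewrite lee_fin local_inf_ge0.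
have gL : (\int[P]_w g h w)%E @[h --> \oo] --> (\int[P]_w (f (X w))%:E)%E.
  rewrite [X in _ --> X](_ : _ = (\int[P]_w limn (g^~ w))%E).
    apply: cvg_monotone_convergence => // w _ h k hk.
    by rewrite lee_fin local_inf_nondecreasing.
  apply: eq_integral => w _; apply/esym/cvg_lim => //.
  by apply: cvg_EFin; [exact: nearW|exact: cvg_local_inf].
move: gL fL; set L := (\int[P]_w (f (X w))%:E)%E => gL fL.
have e20 : 0 < e / 2 by rewrite divr_gt0.
have [h [gf gh]] : exists h, (\int[P]_w g h w)%E \is a fin_num /\
    (L <= \int[P]_w g h w + (e / 2)%:E)%E.
  move: gL; rewrite -(fineK fL) => /fine_cvgP[gf /cvgrPdist_le /(_ _ e20) gh].
  near \oo => h; exists h; have hf : (\int[P]_w g h w)%E \is a fin_num by near: h.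
  split=> //; rewrite -(fineK hf) -EFinD lee_fin.
  have : `|fine L - fine (\int[P]_w g h w)%E| <= e / 2 by near: h.
  by rewrite ler_norml => /andP[_]; lra.
have r0 : 0 <= fine (\int[P]_w g h w)%E by rewrite fine_ge0// integral_ge0.
have fin_le := le_integral_sample (h := h.+1) (g := local_inf f h.+1) _ sX isT
  (@local_local_inf _ f h.+1) (local_inf_ge0 f0 h.+1).
near=> n.
apply: (le_trans gh); rewrite [in leRHS](splitr e) EFinD addeA leeD2r//.
apply: le_trans (_ : _ <= \int[sample_law X n]_q
    (local_inf f h.+1 (root_at (tag_index q)))%:E + (e / 2)%:E)%E _; last first.
  rewrite leeD2r//; apply: ge0_le_integral => //.
  - by move=> q _; rewrite lee_fin local_inf_ge0.
  - by move=> q _; rewrite lee_fin local_inf_le.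
apply: le_trans (leeD (fin_le n) (lexx _)).
move: r0; rewrite -/(g h _) -(fineK gf) /=; set r := fine _ => r0.
rewrite -EFinM -EFinD lee_fin -lerBlDl -[X in X - _]mul1r -mulrBl.
(* With windows of radius [h + 1], at most [2 (h + 1)] of the [n + 1] roots are lost, which costs at
   most [2 (h + 1) r / (n + 1)]; this is below [e / 2] for such [n]. *)
have nN : r * (2 * h.+1%:R) / (e / 2) <= n.+1%:R.
  apply: le_trans (_ : _ <= n%:R) _; last by rewrite ler_nat.
  by near: n; exact: nbhs_infty_ger.
rewrite ler_pdivrMr// in nN.
have n0 : (0 : R) < n.+1%:R by rewrite ltr0n.
set a := _%:R; have -> : (1 - a / n.+1%:R) * r = (n.+1%:R - a) * r / n.+1%:R.
  by rewrite [RHS]mulrAC [in RHS]mulrBl divff ?gt_eqF.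
rewrite ler_pdivrMr//; apply: le_trans (_ : _ <= (2 * h.+1%:R) * r) _; last first.
  by rewrite [leLHS]mulrC [leRHS]mulrC.
rewrite ler_wpM2r// lerBlDr -natrM -natrD ler_nat; lia.
Unshelve. all: by end_near. Qed.

Lemma cvg_in_distribution_sample :
  cvg_in_distribution (sample_law X) (fun n q => root_at (tag_index q)) P X.
Proof.
move=> f cf [M fM]; rewrite unlock.
pose Y (q : rooted_fperm) : rpermM R := root_at (tag_index q).
have mY : measurable_fun [set: rooted_fperm] (f \o Y) by [].
have mX : measurable_fun [set: T] (f \o X) by exact: measurable_continuous_comp.
have bY q : `|(f \o Y) q| <= M by exact: fM.
have bX w : `|(f \o X) w| <= M by exact: fM.
rewrite (bounded_integralE P mX bX).
have EY n := bounded_integralE (sample_law X n) mY bY.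
under eq_fun do rewrite EY.
apply: cvg_EFin; first exact: nearW.
apply/cvgrPdist_le => e e0; near=> n.
(* After cancelling [M], [up] and [lo] are the two one-sided bounds on the difference of the
   expectations of [f]. *)
have up : (\int[P]_w (f (X w) + M)%:E <=
    \int[sample_law X n]_q (f (root_at (tag_index q)) + M)%:E + e%:E)%E.
  near: n; apply: (near_le_integral_sample (f := fun x => f x + M)) => //.
  - by move=> x; apply: cvgD (cf x) (cvg_cst M); exact: nbhs_filter.
  - by move=> x; have := fM x; rewrite ler_norml => /andP[]; lra.
  - by rewrite (bounded_integralD P mX bX).
have lo : (\int[P]_w (M - f (X w))%:E <=
    \int[sample_law X n]_q (M - f (root_at (tag_index q)))%:E + e%:E)%E.
  near: n; apply: (near_le_integral_sample (f := fun x => M - f x)) => //.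
  - by move=> x; apply: cvgB (cvg_cst M) (cf x); exact: nbhs_filter.
  - by move=> x; have := fM x; rewrite ler_norml => /andP[]; lra.
  - by rewrite (bounded_integralB P mX bX).
move: up lo; rewrite (bounded_integralD P mX bX) (bounded_integralB P mX bX).
rewrite (bounded_integralD (sample_law X n) mY bY).
rewrite (bounded_integralB (sample_law X n) mY bY) -!EFinD !lee_fin.
rewrite ler_norml /=; set a := Rintegral P _ _; set b := Rintegral (sample_law X n) _ _.
by move=> up lo; apply/andP; split; lra.
Unshelve. all: by end_near. Qed.

End sample_cvg.

Theorem theorem1p7 (R : realType) (d0 : measure_display)
  (T0 : measurableType d0) (P0 : probability T0 R)
  (X : {RV P0 >-> rpermB R}) (X_infinite : forall w, infinite_rperm (X w)) :
  shift_invariant X <->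
  exists (d : nat -> measure_display) (T : forall n, measurableType (d n))
    (P : forall n, probability (T n) R)
    (sigma : forall n, {RV (P n) >-> fperm})
    (i : forall n w, 'I_(psize (sigma n w))),
    annealed_BS_cvg i X.
Proof.
split=> [sX|[d [T [P [sigma [i]]]]]]; last exact: limit_shift_invariant.
exists (fun=> default_measure_display), (fun=> rooted_fperm), (sample_law X).
exists (sample_fperm X), (fun=> tag_index); split; first exact: uniform_sample.
exact: cvg_in_distribution_sample.
Qed.
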